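(* Let $G=(V,A)$ be a flow graph with start vertex $s$, let $T$ be a rooted tree with the parent property, and let $<$ be a preorder of $T$ that is low-high on $G$. For each vertex $v\neq s$ choose vertices $b(v),r(v)$ by applying exactly one of the following cases that applies (if Cases 1 and 2 both apply, either may be used): Case 1: there are arcs $(u,v),(w,v)\in A$ with $u<v<w$ and $w$ not a descendant of $v$ in $T$; choose two such arcs and set $b(v)=u$, $r(v)=w$. Case 2: $(t(v),v)\in A$ and there is another arc $(u,v)\in A$ with $u<v$; choose such an arc and set $b(v)=u$, $r(v)=t(v)$. Case 3: $(t(v),v)$ is the only arc entering $v$ from a non-descendant of $v$ in $T$; set $b(v)=r(v)=t(v)$. Let $B$ be the subgraph with vertex set $V$ and arcs $\{(b(v),v): v\neq s\}$ and $R$ the subgraph with vertex set $V$ and arcs $\{(r(v),v): v\neq s\}$. Then $B$ and $R$ are strongly independent spanning trees of $G$ rooted at $s$.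
   Context: A flow graph is a finite directed graph $G=(V,A)$ with a designated start vertex $s$ such that every vertex is reachable from $s$; throughout, there are no arcs entering $s$ and $|V|>1$. A vertex $v$ dominates $w$ if every path from $s$ to $w$ contains $v$. For a rooted tree $T$, $t(v)$ denotes the parent of $v$; ancestors and descendants include the vertex itself. $T$ has the parent property if for every arc $(v,w)\in A$, $t(w)$ is an ancestor of $v$ in $T$. A preorder of $T$ is a total order of its vertices such that for every vertex $v$, the descendants of $v$ are ordered consecutively with $v$ first. A preorder of $T$ is low-high on $G$ if for every $v\neq s$, either $(t(v),v)\in A$, or there are two arcs $(u,v),(w,v)\in A$ with $u<v<w$ and $w$ not a descendant of $v$ in $T$. For a spanning tree $B$ rooted at $s$, $B[s,v]$ denotes the path in $B$ from $s$ to $v$. Two spanning trees $B$, $R$ rooted at $s$ are strongly independent if for every pair of vertices $v,w$, either $B[s,v]$ and $R[s,w]$ share only vertices that dominate both $v$ and $w$, or $R[s,v]$ and $B[s,w]$ share only vertices that dominate both $v$ and $w$. *)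

(* Defs.v *)
From mathcomp Require Import all_boot.

Set Implicit Arguments.
Unset Strict Implicit.
Unset Printing Implicit Defensive.

(* A finite directed graph is an arc relation [A : rel V] on a finite type: *)
(* arcs are ordered pairs, so there are no parallel arcs.                   *)

Definition flow_graph (V : finType) (A : rel V) (s : V) : Prop :=
  [/\ 1 < #|V|, forall v, ~~ A v s & forall v, connect A s v].

Definition dominates (V : finType) (A : rel V) (s v w : V) : Prop :=
  forall p : seq V, path A s p -> last s p = w -> v \in s :: p.

(* The directed graph with vertex set [X] and arcs [E] is a tree rooted at  *)
(* [r], with arcs directed from parent to child.                            *)
Definition is_rooted_tree (V : finType) (X : {set V}) (E : rel V) (r : V)
    : Prop :=
  [/\ r \in X,
      forall u v, E u v -> (u \in X) && (v \in X),
      forall u, ~~ E u r,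
      forall v, v \in X -> v != r -> exists! u, E u v
    & forall v, v \in X -> connect E r v].

(* Neither the vertex set nor the root is fixed in advance: for a flow      *)
(* graph, the parent property forces them to be [V] and [s].                *)
Record rooted_tree (V : finType) := RootedTree {
  tree_verts : {set V};
  tree_root : V;
  is_parent : rel V; (* [is_parent p v] reads [p = t(v)] *)
  rooted_treeP : is_rooted_tree tree_verts is_parent tree_root
}.

Definition ancestor (V : finType) (T : rooted_tree V) : rel V :=
  fun u v => (u \in tree_verts T) && connect (is_parent T) u v.

Definition descendant (V : finType) (T : rooted_tree V) : rel V :=
  fun u v => ancestor T v u.

Definition parent_property (V : finType) (A : rel V) (T : rooted_tree V)
    : Prop :=
  forall v w, A v w -> exists2 p, is_parent T p w & ancestor T p v.

Definition strict_total_order_on (V : finType) (X : {set V}) (lt : rel V)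
    : Prop :=
  [/\ {in X, irreflexive lt},
      {in X & &, transitive lt}
    & {in X &, forall u v, u != v -> lt u v || lt v u}].

Definition tree_preorder (V : finType) (T : rooted_tree V) (lt : rel V)
    : Prop :=
  [/\ strict_total_order_on (tree_verts T) lt,
      forall u v, descendant T u v -> u != v -> lt v u
    & forall u v w x, descendant T u v -> descendant T w v ->
        x \in tree_verts T -> lt u x -> lt x w -> descendant T x v].

Definition low_high (V : finType) (A : rel V) (s : V) (T : rooted_tree V)
    (lt : rel V) : Prop :=
  forall v, v != s ->
    (exists2 p, is_parent T p v & A p v) \/
    (exists u w, [/\ A u v, A w v, lt u v, lt v w & ~~ descendant T w v]).

Definition choice_case1 (V : finType) (A : rel V) (T : rooted_tree V)
    (lt : rel V) (v bv rv : V) : Prop :=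
  [/\ A bv v, A rv v, lt bv v, lt v rv & ~~ descendant T rv v].

Definition choice_case2 (V : finType) (A : rel V) (T : rooted_tree V)
    (lt : rel V) (v bv rv : V) : Prop :=
  [/\ is_parent T rv v, A rv v, A bv v, bv != rv & lt bv v].

Definition choice_case3 (V : finType) (A : rel V) (T : rooted_tree V)
    (v bv rv : V) : Prop :=
  [/\ is_parent T rv v, A rv v,
      forall u, A u v -> ~~ descendant T u v -> u = rv
    & bv = rv].

(* The arcs (f(v), v) for v <> s; the value of [f] at [s] is irrelevant.    *)
Definition choice_arcs (V : finType) (s : V) (f : V -> V) : rel V :=
  fun u v => (v != s) && (u == f v).

Definition spanning_tree (V : finType) (A : rel V) (s : V) (E : rel V)
    : Prop :=
  subrel E A /\ is_rooted_tree [set: V] E s.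

(* [x] lies on E[s, v]; when [E] is a spanning tree rooted at [s], the path *)
(* [s :: p] exists and is unique.                                           *)
Definition on_tree_path (V : finType) (E : rel V) (s v x : V) : Prop :=
  exists p : seq V, [/\ path E s p, last s p = v & x \in s :: p].

Definition share_only_dominators (V : finType) (A : rel V) (s : V)
    (E F : rel V) (v w : V) : Prop :=
  forall x, on_tree_path E s v x -> on_tree_path F s w x ->
    dominates A s x v /\ dominates A s x w.

Definition strongly_independent (V : finType) (A : rel V) (s : V)
    (B R : rel V) : Prop :=
  forall v w, share_only_dominators A s B R v w \/
              share_only_dominators A s R B v w.

(* Main.v *)
Require Import Defs.
From mathcomp Require Import all_boot.

(** The parent property makes every ancestor in [T] a dominator: a path that
    enters the subtree of [x] can do so only at [x].  Besides the preorder
    [<], consider the order [<'] in which siblings are visited in reverse: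
    [x <' v] when [x] is a proper ancestor of [v], or [v < x] and [x] is not a
    descendant of [v].  Each case of the construction gives [b v < v] and
    [r v <' v], so that [B] and [R] are trees whose arcs increase along [<] and
    [<'] respectively.  If [v <= w] and [x] lies on both [B[s, v]] and
    [R[s, w]], then [x <= v <= w] and [x <=' w]; hence [x] is an ancestor
    of [w], and of [v] too because the descendants of [x] are consecutive. *)

Set Implicit Arguments.
Unset Strict Implicit.
Unset Printing Implicit Defensive.

Section ChoiceArcs.
Variables (V : finType) (s : V) (f : V -> V) (o : rel V).
Hypotheses (o_irr : irreflexive o) (o_trans : transitive o).
Hypothesis f_lt : forall v, v != s -> o (f v) v.

(** Iterating [f] descends strictly along [o], so on a finite type it must stop, and it can stop
    only at [s]. The induction is on the number of [o]-predecessors of the vertex. *)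
Lemma choice_arcs_tree : is_rooted_tree [set: V] (choice_arcs s f) s.
Proof.
split=> [|u v _|u|v _ vs|v _]; rewrite ?inE //.
- by rewrite /choice_arcs eqxx.
- exists (f v); split=> [|u /andP[_ /eqP->]] //.
  by rewrite /choice_arcs vs eqxx.
have [n] := ubnP #|[set u | o u v]|; elim: n v => // n IHn v.
rewrite ltnS => lt_n.
have [-> //|vs] := eqVneq v s.
apply: connect_trans (connect1 (_ : choice_arcs s f (f v) v)); last first.
  by rewrite /choice_arcs vs eqxx.
apply: IHn; apply: leq_trans lt_n; apply/proper_card/properP; split.
  by apply/subsetP=> u; rewrite !inE => /o_trans; apply; apply: f_lt.
by exists (f v); rewrite !inE ?f_lt // o_irr.
Qed.

Lemma on_choice_path v x :
  on_tree_path (choice_arcs s f) s v x -> x = v \/ o x v.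
Proof.
case=> p [sp + x_in]; case/splitPl: x_in sp => p1 p2 <-.
(* Only the part of the path from [x] to [v] matters; its start is generalized for the induction. *)
rewrite cat_path last_cat => /andP[_]; move: (last s p1) => y.
elim: p2 y => [|z p2 IHp] y /=; first by left.
case/andP=> /andP[zs /eqP->] /IHp{}IHp /IHp[<-|oz]; right; first exact: f_lt.
exact: o_trans (f_lt zs) oz.
Qed.

End ChoiceArcs.

Section Tree.
Variables (V : finType) (X : {set V}) (E : rel V) (s : V).
Hypothesis ET : is_rooted_tree X E s.

Lemma tree_parent_uniq u u' v : E u v -> E u' v -> u = u'.
Proof.
case: ET => _ EX Es uniqE _ uv u'v.
have /andP[_ vX] := EX _ _ uv.
have vs : v != s by apply: contraTneq uv => ->.
by have [w [_ wP]] := uniqE v vX vs; rewrite -(wP _ uv) -(wP _ u'v).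
Qed.

(** The last arc of a nontrivial path to [z] must leave the only parent of [z]. *)
Lemma tree_connect_parent x q z :
  connect E x z -> x != z -> E q z -> connect E x q.
Proof.
case/connectP=> p; case/lastP: p => [|p y] /= + ->; first by rewrite eqxx.
rewrite rcons_path last_rcons => /andP[xp py] _ qy.
by rewrite (tree_parent_uniq qy py); apply/connectP; exists p.
Qed.

(** A loop at [v] would be its only incoming arc, so a walk from any other vertex, in particular
    from [s], could never arrive at [v]. *)
Lemma tree_parent_neq v : ~~ E v v.
Proof.
apply/negP=> vv; case: ET => _ EX Es _ conn.
have /andP[vX _] := EX _ _ vv.
have /connectP[p] := conn v vX.
have: s != v by apply: contraTneq vv => <-.
elim: p s {conn Es} => [|z p IHp] y yv /=.
  by move=> _ vy; rewrite vy eqxx in yv.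
case/andP=> yz; apply: IHp; apply: contraNneq yv => zv.
by rewrite zv in yz; rewrite (tree_parent_uniq yz vv).
Qed.

Lemma tree_ancestor_root x : connect E x s -> x = s.
Proof.
case/connectP=> p; case/lastP: p => [|p y] //=.
rewrite rcons_path last_rcons => /andP[_ py] sy.
by case: ET => _ _ Es _ _; have:= Es (last x p); rewrite sy py.
Qed.

End Tree.

Section ParentProperty.
Variables (V : finType) (A : rel V) (s : V) (T : rooted_tree V).
Hypotheses (hG : flow_graph A s) (hT : parent_property A T).

Lemma flow_graph_pred v : v != s -> exists u, A u v.
Proof.
case: hG => _ _ /(_ v)/connectP[p].
case/lastP: p => [|p y] /= + -> ; first by rewrite eqxx.
by rewrite rcons_path last_rcons => /andP[_ py] _; exists (last s p).
Qed.

(** Any vertex other than [s] has an entering arc of [A], hence a parent in [T], which the root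
    cannot have. *)
Lemma parent_property_root : tree_root T = s.
Proof.
apply/eqP/negPn/negP=> /flow_graph_pred[u /hT[p pr _]].
by case: (rooted_treeP T) => _ _ /(_ p); rewrite pr.
Qed.

Lemma parent_property_verts v : v \in tree_verts T.
Proof.
case: (rooted_treeP T) => rX EX _ _ _.
have [->|vs] := eqVneq v s; first by rewrite -parent_property_root.
by have [u /hT[p /EX/andP[]]] := flow_graph_pred vs.
Qed.

Lemma ancestorE u v : ancestor T u v = connect (is_parent T) u v.
Proof. by rewrite /ancestor parent_property_verts. Qed.

Lemma ancestor_dominates x v : ancestor T x v -> dominates A s x v.
Proof.
have TT := rooted_treeP T; rewrite parent_property_root in TT.
rewrite ancestorE => xv p sp pv; rewrite inE.
have [//|xs /=] := eqVneq x s.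
have nxs : ~~ connect (is_parent T) x s.
  by apply: contra xs => /(tree_ancestor_root TT)->.
(* The induction lets the path start at any vertex outside the subtree of [x]. *)
rewrite -pv {v pv} in xv; elim: p s sp nxs xv {TT xs} => [|z p IHp] y /=.
  by move=> _ /negPf->.
case/andP=> yz zp nxy xl; rewrite inE.
have [//|xz /=] := eqVneq x z.
apply: IHp zp _ xl; apply: contra nxy => cxz.
(* If [z] were properly below [x], its parent [q] would be below [x] too; the parent property puts
   [q] above [y], so [y] would lie below [x]. *)
have [q qz] := hT yz; rewrite ancestorE; apply: connect_trans.
exact: (tree_connect_parent (rooted_treeP T)) cxz xz qz.
Qed.

End ParentProperty.

Definition reverse_preorder (V : finType) (T : rooted_tree V) (lt : rel V)
    : rel V :=
  fun x v => (x != v) && ancestor T x v || lt v x && ~~ ancestor T v x.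

Section ReversePreorder.
Variables (V : finType) (T : rooted_tree V) (lt : rel V).
Hypotheses (allT : forall v, v \in tree_verts T) (hpre : tree_preorder T lt).

Lemma preorder_irr : irreflexive lt.
Proof. by case: hpre => -[irr _ _] _ _ x; apply: irr. Qed.

Lemma preorder_trans : transitive lt.
Proof. by case: hpre => -[_ tr _] _ _ y x z; apply: tr. Qed.

Lemma preorder_total u v : [\/ u = v, lt u v | lt v u].
Proof.
case: hpre => -[_ _ tot] _ _.
have [->|uv] := eqVneq u v; first by constructor 1.
by have /orP[] := tot _ _ (allT u) (allT v) uv; [constructor 2|constructor 3].
Qed.

Lemma ancestor_refl v : ancestor T v v.
Proof. by rewrite /ancestor allT connect0. Qed.

Lemma ancestor_trans : transitive (ancestor T).
Proof.
move=> y x z; rewrite /ancestor !allT; exact: connect_trans.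
Qed.

Lemma ancestor_lt u v : ancestor T u v -> u != v -> lt u v.
Proof. by case: hpre => _ anc_lt _ uv; rewrite eq_sym; apply: anc_lt. Qed.

Lemma ancestor_between x y z :
  ancestor T x z -> x = y \/ lt x y -> y = z \/ lt y z -> ancestor T x y.
Proof.
move=> xz [->|xy]; first by rewrite ancestor_refl.
move=> [->//|yz]; case: hpre => _ _ /(_ x x z y); apply => //.
exact: ancestor_refl.
Qed.

Lemma ancestor_anti x y : ancestor T x y -> ancestor T y x -> x = y.
Proof.
move=> xy yx; apply/eqP/negPn/negP=> nxy.
have := preorder_trans (ancestor_lt xy nxy) (ancestor_lt yx _).
by rewrite preorder_irr eq_sym => /(_ nxy).
Qed.

Lemma reverse_preorder_irr : irreflexive (reverse_preorder T lt).
Proof. by move=> x; rewrite /reverse_preorder eqxx preorder_irr. Qed.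

Lemma reverse_preorder_trans : transitive (reverse_preorder T lt).
Proof.
move=> y x z /orP[] /andP[xy1 xy2] /orP[] /andP[yz1 yz2]; apply/orP.
- left; rewrite (ancestor_trans xy2 yz2) andbT.
  apply: contraNneq xy1 => xz; rewrite -xz in yz2.
  by rewrite (ancestor_anti xy2 yz2).
(* Here [z < y] with [y] below [x]: if [x < z], then [z] falls inside the block of descendants of
   [x]; if [z < x], the second disjunct holds. *)
- have [xz|xz|zx] := preorder_total x z.
  + by rewrite -xz xy2 in yz2.
  + left; rewrite (ancestor_between xy2 (or_intror xz) (or_intror yz1)) andbT.
    by apply: contraTneq xz => ->; rewrite preorder_irr.
  + by right; rewrite zx; apply: contra yz2 => /ancestor_trans; apply.
- right; apply/andP; split; last first.
    by apply: contra xy2; apply: ancestor_trans.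
  (* If [x < z], then [y < x < z] would put [x] in the block of descendants of [y]. *)
  have [zx|//|xz] := preorder_total z x; first by rewrite -zx yz2 in xy2.
  by rewrite (ancestor_between yz2 (or_intror xy1) (or_intror xz)) in xy2.
- right; rewrite (preorder_trans yz1 xy1); apply: contra yz2 => zx.
  exact: ancestor_between zx (or_intror yz1) (or_intror xy1).
Qed.

Lemma common_ancestor x v w :
    v = w \/ lt v w -> x = v \/ lt x v -> x = w \/ reverse_preorder T lt x w ->
  ancestor T x v /\ ancestor T x w.
Proof.
move=> vw xv xw.
suff xaw : ancestor T x w by split; rewrite // (ancestor_between xaw).
case: xw => [->|/orP[/andP[] //|/andP[wx _]]]; first exact: ancestor_refl.
(* In the remaining case [w < x <= v], against [v <= w]. *)
have wv : lt w v by case: xv => [<-//|]; apply: preorder_trans wx.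
have: lt w w by case: vw wv => [->//|vw wv]; apply: preorder_trans wv vw.
by rewrite preorder_irr.
Qed.

End ReversePreorder.

Theorem theorem8 (V : finType) (A : rel V) (s : V) (T : rooted_tree V)
  (lt : rel V) (b r : V -> V)
  (hG : flow_graph A s)
  (hT : parent_property A T)
  (hpre : tree_preorder T lt)
  (hlh : low_high A s T lt)
  (hbr : forall v, v != s ->
     [\/ choice_case1 A T lt v (b v) (r v),
         choice_case2 A T lt v (b v) (r v)
       | choice_case3 A T v (b v) (r v)]) :
  [/\ spanning_tree A s (choice_arcs s b),
      spanning_tree A s (choice_arcs s r)
    & strongly_independent A s (choice_arcs s b) (choice_arcs s r)].
Proof.
have allT := parent_property_verts hG hT.
have parent_anc p v : is_parent T p v -> (p != v) && ancestor T p v.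
  move=> pv; rewrite (ancestorE hG hT) connect1 // andbT.
  by apply: contraTneq pv => ->; apply: tree_parent_neq (rooted_treeP T) _.
have b_lt v : v != s -> lt (b v) v.
  move=> /hbr[[]|[]|[pv _ _ ->]] //.
  by have /andP[nv av] := parent_anc _ _ pv; apply: ancestor_lt hpre _ _ av nv.
(* Case 1 gives the second disjunct of [reverse_preorder]; in Cases 2 and 3, [r v] is the parent of
   [v], a proper ancestor. *)
have r_lt v : v != s -> reverse_preorder T lt (r v) v.
  move=> /hbr[[_ _ _ vr nvr]|[/parent_anc pv _ _ _ _]|[/parent_anc pv _ _ _]].
  - by apply/orP; right; rewrite vr.
  - by apply/orP; left.
  - by apply/orP; left.
have lt_irr := preorder_irr allT hpre.
have lt_trans := preorder_trans allT hpre.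
have gt_irr := reverse_preorder_irr allT hpre.
have gt_trans := reverse_preorder_trans allT hpre.
split.
- split; last exact: choice_arcs_tree lt_irr lt_trans b_lt.
  by move=> u v /andP[/hbr + /eqP->]; case=> [[]|[]|[_ ? _ ->]].
- split; last exact: choice_arcs_tree gt_irr gt_trans r_lt.
  by move=> u v /andP[/hbr + /eqP->]; case=> [[]|[]|[]].
have shared v w x : v = w \/ lt v w ->
    on_tree_path (choice_arcs s b) s v x ->
    on_tree_path (choice_arcs s r) s w x ->
  dominates A s x v /\ dominates A s x w.
  move=> vw /(on_choice_path lt_trans b_lt) xv.
  move=> /(on_choice_path gt_trans r_lt) xw.
  have [av aw] := common_ancestor allT hpre vw xv xw.
  by split; apply: (ancestor_dominates hG hT).
move=> v w; have [vw|vw|wv] := preorder_total allT hpre v w.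
- by left=> x; apply: (shared v w x (or_introl vw)).
- by left=> x; apply: (shared v w x (or_intror vw)).
(* Exchanging [v] and [w] exchanges the trees, which is the second alternative of strong
   independence. *)
- by right=> x xv xw; have [] := shared w v x (or_intror wv) xw xv.
Qed.
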